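(* If $G$ and $H$ are graphs, then $$M(G\times H;x,y)=\sum_{i_1\le i_2}\ \sum_{j_1\le j_2} m_{i_1,i_2}(G)\, m_{j_1,j_2}(H)\Bigl(x^{\min\{i_1j_1,\,i_2j_2\}}y^{\max\{i_1j_1,\,i_2j_2\}}+x^{\min\{i_1j_2,\,i_2j_1\}}y^{\max\{i_1j_2,\,i_2j_1\}}\Bigr).$$
   Context: All graphs are finite, simple, and undirected. For a graph $G$, $\deg_G(g)$ denotes the degree of $g\in V(G)$. For $i\le j$ let $m_{i,j}(G)=|\{\{g,g'\}\in E(G): \{\deg_G(g),\deg_G(g')\}=\{i,j\}\}|$. The M-polynomial of $G$ is $M(G;x,y)=\sum_{i\le j} m_{i,j}(G)\,x^iy^j$. The direct product $G\times H$ has vertex set $V(G)\times V(H)$; vertices $(g_1,h_1)$ and $(g_2,h_2)$ are adjacent if $g_1g_2\in E(G)$ and $h_1h_2\in E(H)$. In the sums, $i_1\le i_2$ range over (pairs of) vertex degrees of $G$ and $j_1\le j_2$ over (pairs of) vertex degrees of $H$. *)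

(* Defs.v *)
From HB Require Import structures.
From mathcomp Require Import all_boot all_order all_algebra.
From mathcomp Require Import mpoly.

Set Implicit Arguments.
Unset Strict Implicit.
Unset Printing Implicit Defensive.

Import GRing.Theory.
Local Open Scope ring_scope.

Record sgraph := SGraph {
  vertex :> finType;
  adj : rel vertex;
  adj_sym : ssrbool.symmetric adj;
  adj_irrefl : irreflexive adj
}.

Definition edges (G : sgraph) : {set {set G}} :=
  [set [set p.1; p.2] | p : G * G & adj p.1 p.2].

Definition deg (G : sgraph) (g : G) : nat := #|[set g' | adj g g']|.

Definition degrees (G : sgraph) : seq nat := undup [seq deg g | g : G].

(* The equality of unordered pairs {deg g, deg g'} = {i, j} is [perm_eq]. *)
Definition medges (G : sgraph) (i j : nat) : nat :=
  #|[set e in edges G | [exists g : G, exists g' : G,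
       (e == [set g; g']) && perm_eq [:: deg g; deg g'] [:: i; j]]]|.

Definition varx : {mpoly int[2]} := 'X_(ord0 : 'I_2).
Definition vary : {mpoly int[2]} := 'X_(ord_max : 'I_2).

(* [medges G i j] is 0 unless i and j are both vertex degrees of G, so the sum
   over all i <= j is the finite sum over pairs of vertex degrees. *)
Definition Mpoly (G : sgraph) : {mpoly int[2]} :=
  \sum_(i <- degrees G) \sum_(j <- degrees G | (i <= j)%N)
    (medges G i j)%:R * (varx ^+ i * vary ^+ j).

Section DirectProduct.
Variables G H : sgraph.

Definition dprod_adj : rel (G * H)%type :=
  fun u v => adj u.1 v.1 && adj u.2 v.2.

Lemma dprod_adj_sym : ssrbool.symmetric dprod_adj.
Proof. by move=> u v; rewrite /dprod_adj (adj_sym u.1) (adj_sym u.2). Qed.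

Lemma dprod_adj_irrefl : irreflexive dprod_adj.
Proof. by move=> u; rewrite /dprod_adj adj_irrefl. Qed.

Definition direct_product : sgraph := SGraph dprod_adj_sym dprod_adj_irrefl.

End DirectProduct.

(* Main.v *)
(** Sum over ordered pairs of adjacent vertices instead of over edges.  For a
    symmetric [f], such a sum of [f (deg u) (deg v)] counts each edge twice, so
    it equals twice the sum of [m_{i,j} f(i,j)] over [i <= j].  On ordered pairs
    the sum over the direct product factors as a double sum over G and H,
    because degrees multiply.  Both sides of the identity, multiplied by 4, are
    then the same double sum, the two terms on the right being exchanged by
    reversing the pair of H; finally 4 is cancelled in characteristic zero. *)
Require Import Defs.
From HB Require Import structures.
From mathcomp Require Import all_boot all_order all_algebra.
From mathcomp Require Import mpoly.

Set Implicit Arguments.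
Unset Strict Implicit.
Unset Printing Implicit Defensive.

Import GRing.Theory.
Local Open Scope ring_scope.

Lemma mem_degrees (G : sgraph) (g : G) : deg g \in degrees G.
Proof. by rewrite mem_undup; apply/mapP; exists g; rewrite ?mem_enum. Qed.

(** For [i <= j] the degree class is fixed by the minimum and maximum of the two end degrees, so in
    a sum over [i <= j] a single term survives. *)
Lemma perm_eq_pair (a b i j : nat) : (i <= j)%N ->
  perm_eq [:: a; b] [:: i; j] = (i == minn a b) && (j == maxn a b).
Proof.
move=> le_ij; apply/idP/andP => [pab | [/eqP-> /eqP->]]; last first.
  by case: leqP => // _; rewrite (perm_catC [:: a] [:: b]).
have := perm_mem pab; have : (a + b = i + j)%N.
  by have := perm_sumn pab; rewrite /= !addn0.
move=> sab mab; have := mab a; rewrite !inE eqxx /= => /esym/orP[] /eqP eqa.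
  move: sab; rewrite eqa => /addnI->; rewrite (minn_idPl le_ij) (maxn_idPr le_ij).
  by rewrite !eqxx.
move: sab; rewrite eqa [(i + j)%N]addnC => /addnI->.
by rewrite (minn_idPr le_ij) (maxn_idPl le_ij) !eqxx.
Qed.

Lemma adj_neq (G : sgraph) (g h : G) : adj g h -> g != h.
Proof. by apply: contraTneq => ->; rewrite adj_irrefl. Qed.

Definition arcs (G : sgraph) (i j : nat) : {set G * G} :=
  [set p | adj p.1 p.2 && perm_eq [:: deg p.1; deg p.2] [:: i; j]].

Lemma set2_eq (T : finType) (a b c d : T) : c != d ->
  ([set c; d] == [set a; b]) = ((c, d) \in [:: (a, b); (b, a)]).
Proof.
move=> neq_cd; rewrite !inE !xpair_eqE; apply/eqP/idP => [eq_s | ]; last first.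
  by case/orP=> /andP[/eqP-> /eqP->] //; rewrite setUC.
have := set21 c d; have := set22 c d; rewrite eq_s !inE.
case/orP=> /eqP ed /orP[] /eqP ec; move: neq_cd; rewrite ed ec ?eqxx ?orbT //.
Qed.

(** Forgetting the orientation maps arcs onto edges, and each fibre [{(u, v), (v, u)}] has two
    elements because there are no loops. *)
Lemma card_arcs (G : sgraph) (i j : nat) : #|arcs G i j| = (medges G i j).*2.
Proof.
pose s (p : G * G) := [set p.1; p.2].
have -> : medges G i j = #|s @: arcs G i j|.
  apply: eq_card => e; rewrite inE; apply/andP/imsetP => [[] | [p]].
    case/imsetP=> -[u v] /= /[!inE] /= uv ->.
    case/existsP=> g /existsP[h /andP[eq_s dgh]].
    exists (g, h); last exact/eqP.
    rewrite inE dgh andbT /=.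
    move: eq_s; rewrite set2_eq ?adj_neq // !inE.
    by case/orP=> /eqP[<- <-] //; rewrite adj_sym.
  rewrite inE => /andP[pp dp] ->; split.
    by apply/imsetP; exists p; rewrite /= ?inE.
  by apply/existsP; exists p.1; apply/existsP; exists p.2; rewrite eqxx.
rewrite -sum1_card (partition_big_imset s) /= -muln2 -sum_nat_const.
apply: eq_bigr => _ /imsetP[[u v] uv ->].
have [adj_uv duv] : adj u v /\ perm_eq [:: deg u; deg v] [:: i; j].
  by move: uv; rewrite inE => /andP.
rewrite (eq_bigl (mem [set (u, v); (v, u)])) ?sum1_card ?cards2.
  by rewrite xpair_eqE negb_and adj_neq.
case=> c d; rewrite !inE /s /=; apply/andP/idP.
  by case=> /andP[/adj_neq cd _]; rewrite set2_eq ?inE.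
case/orP=> /eqP[-> ->]; first by rewrite adj_uv duv eqxx.
by rewrite adj_sym adj_uv (perm_catC [:: deg v] [:: deg u]) duv setUC eqxx.
Qed.

(** Degree-grouped form of a sum over edges: [Mpoly] is the case [f = Mmon], and the right-hand side
    of the theorem nests two instances. *)
Definition degree_sum (A : nmodType) (G : sgraph) (f : nat -> nat -> A) : A :=
  \sum_(i <- degrees G) \sum_(j <- degrees G | (i <= j)%N) f i j *+ medges G i j.

Lemma sum_adj (A : nmodType) (G : sgraph) (f : nat -> nat -> A) :
  (forall i j, f i j = f j i) ->
  \sum_(p : G * G | adj p.1 p.2) f (deg p.1) (deg p.2) = degree_sum G f *+ 2.
Proof.
move=> fC; rewrite /degree_sum.
under eq_bigr => p adj_p.
  (* The value is spread over all classes [i <= j], only one of them contributing, so that the sums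
     can be exchanged and the arcs counted class by class. *)
  have -> : f (deg p.1) (deg p.2) =
      \sum_(i <- degrees G) \sum_(j <- degrees G | (i <= j)%N)
         (if perm_eq [:: deg p.1; deg p.2] [:: i; j] then f i j else 0).
    set a := deg p.1; set b := deg p.2.
    have [min_deg max_deg] : minn a b \in degrees G /\ maxn a b \in degrees G.
      by case: leqP; rewrite !mem_degrees.
    rewrite (bigD1_seq (minn a b)) ?undup_uniq //= [X in _ + X]big1 ?addr0.
      have le_ab : (minn a b <= maxn a b)%N by rewrite geq_min leq_maxl.
      rewrite big_mkcond (bigD1_seq (maxn a b)) ?undup_uniq //= [X in _ + X]big1.
        rewrite le_ab perm_eq_pair // !eqxx addr0.
        (* When [b < a] the surviving term is [f b a], and the symmetry [fC] is what closes the
           case. *)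
        by case: leqP.
      move=> j ne_j; case: ifP => // le_j; rewrite perm_eq_pair //.
      by rewrite (negPf ne_j) andbF.
    move=> i ne_i; rewrite big1 // => j le_ij.
    by rewrite perm_eq_pair // (negPf ne_i).
  over.
rewrite exchange_big -sumrMnl; apply: eq_bigr => i _ /=.
rewrite exchange_big -sumrMnl; apply: eq_bigr => j le_ij /=.
rewrite -big_mkcondr /= sumr_const -mulrnA muln2 -card_arcs.
by congr (_ *+ _); apply: eq_card => p; rewrite !inE.
Qed.

(** The neighbourhood of a vertex is the Cartesian product of the neighbourhoods of its
    components. *)
Lemma deg_dprod (G H : sgraph) (u : direct_product G H) :
  deg u = (deg u.1 * deg u.2)%N.
Proof.
by rewrite /deg -cardsX; apply: eq_card => v; rewrite !inE.
Qed.

(** Regrouping coordinates is a bijection between arcs of the product and pairs of arcs; a pair of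
    unoriented edges would instead yield two edges of the product. *)
Lemma sum_dprod_adj (A : nmodType) (G H : sgraph) (f : nat -> nat -> A) :
  \sum_(p : direct_product G H * direct_product G H | adj p.1 p.2)
     f (deg p.1) (deg p.2) =
  \sum_(p : G * G | adj p.1 p.2) \sum_(q : H * H | adj q.1 q.2)
     f (deg p.1 * deg q.1)%N (deg p.2 * deg q.2)%N.
Proof.
rewrite pair_big /=.
pose swap (r : (G * G) * (H * H)) : direct_product G H * direct_product G H :=
  ((r.1.1, r.2.1), (r.1.2, r.2.2)).
rewrite (reindex swap) /=; last first.
  exists (fun p => ((p.1.1, p.2.1), (p.1.2, p.2.2))).
    by case=> [[? ?] [? ?]].
  by case=> [[? ?] [? ?]].
by apply: eq_bigr => r _; rewrite !deg_dprod.
Qed.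

(** Coefficients can be compared one by one, and the integers have no torsion. *)
Lemma mpoly_int_mulrnI (n k : nat) : (0 < k)%N ->
  injective (fun p : {mpoly int[n]} => p *+ k).
Proof.
move=> k_gt0 p q /= eq_pq; apply/mpolyP => m.
have /(congr1 (mcoeff m)) := eq_pq; rewrite !mcoeffMn.
exact: Num.Theory.pmulrnI.
Qed.

(** The minimum and maximum make the monomial symmetric, as [sum_adj] requires; for [i <= j] it is
    the monomial of the M-polynomial. *)
Definition Mmon (i j : nat) : {mpoly int[2]} :=
  varx ^+ minn i j * vary ^+ maxn i j.

Lemma MmonC (i j : nat) : Mmon i j = Mmon j i.
Proof. by rewrite /Mmon minnC maxnC. Qed.

Lemma MpolyE (G : sgraph) : Mpoly G = degree_sum G Mmon.
Proof.
apply: eq_bigr => i _; apply: eq_bigr => j le_ij.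
by rewrite /Mmon (minn_idPl le_ij) (maxn_idPr le_ij) mulr_natl.
Qed.

Theorem theorem3p2 (G H : sgraph) :
  Mpoly (direct_product G H) =
  \sum_(i1 <- degrees G) \sum_(i2 <- degrees G | (i1 <= i2)%N)
    \sum_(j1 <- degrees H) \sum_(j2 <- degrees H | (j1 <= j2)%N)
      (medges G i1 i2)%:R * (medges H j1 j2)%:R *
      (varx ^+ minn (i1 * j1) (i2 * j2) * vary ^+ maxn (i1 * j1) (i2 * j2) +
       varx ^+ minn (i1 * j2) (i2 * j1) * vary ^+ maxn (i1 * j2) (i2 * j1)).
Proof.
(* [T] is symmetric in each of its two pairs of degrees, so [sum_adj] will apply to [G] and to [H]
   in turn. *)
pose T i1 i2 j1 j2 : {mpoly int[2]} :=
  Mmon (i1 * j1) (i2 * j2) + Mmon (i1 * j2) (i2 * j1).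
have TCr i1 i2 j1 j2 : T i1 i2 j1 j2 = T i1 i2 j2 j1 by rewrite /T addrC.
have TCl i1 i2 j1 j2 : T i1 i2 j1 j2 = T i2 i1 j1 j2.
  by rewrite /T addrC; congr (_ + _); apply: MmonC.
transitivity (degree_sum G (fun i1 i2 => degree_sum H (T i1 i2))); last first.
  apply: eq_bigr => i1 _; apply: eq_bigr => i2 _.
  rewrite -sumrMnl; apply: eq_bigr => j1 _.
  rewrite -sumrMnl; apply: eq_bigr => j2 _.
  by rewrite -[RHS]mulrA !mulr_natl.
(* Here 4 is 2 times 2. On the right, one factor orients the edges of [G] and the other those of
   [H]; on the left, one orients the edges of the product and the other leaves two copies of the
   sum, one for each term of [T]. *)
apply: (@mpoly_int_mulrnI _ 4) => //.
rewrite MpolyE (mulrnA _ 2 2) -(sum_adj _ MmonC) sum_dprod_adj.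
rewrite (mulrnA _ 2 2) -sum_adj; last first.
  move=> i1 i2; apply: eq_bigr => j1 _; apply: eq_bigr => j2 _.
  by rewrite TCl.
rewrite -!sumrMnl; apply: eq_bigr => p _.
rewrite -sum_adj; last exact: TCr.
rewrite /T big_split /= mulr2n; congr (_ + _).
rewrite (reindex_inj (can_inj (@swap_pairK H H))) /=.
by apply: eq_bigl => q; rewrite adj_sym.
Qed.
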